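(* Let $k\ge 2$ be an integer. If, for some integer $n\ge 2$, $$e\,\Biggl[\binom{n}{k}-\binom{n-k}{k}-k\binom{n-k}{k-1}\Biggr]\,2^{1-\binom{k}{2}}\le 1,$$ then $R(k,k)>n$.
   Context: For integers $k,\ell\ge 2$, the Ramsey number $R(k,\ell)$ is the smallest integer $n\ge 2$ such that every $2$-coloring of the edges of the complete graph $K_n$ contains either a monochromatic copy of $K_k$ in the first color or a monochromatic copy of $K_\ell$ in the second color. $e$ is the base of the natural logarithm. Convention: $\binom{a}{b}=0$ whenever $a<b$ (including negative $a$). *)

(* Defs.v *)
From mathcomp Require Import all_boot.
From mathcomp Require Import zify.

Set Implicit Arguments.
Unset Strict Implicit.
Unset Printing Implicit Defensive.

Local Open Scope nat_scope.

(* The edges of the complete graph on T are the two-element subsets of T.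
   A 2-coloring is a function on all of {set T}, but only its values on edges
   are ever inspected. *)
Definition is_mono (T : finType) (c : {set T} -> bool) (b : bool)
    (A : {set T}) : bool :=
  [forall e : {set T}, (#|e| == 2) && (e \subset A) ==> (c e == b)].

Definition has_mono_copy (T : finType) (c : {set T} -> bool) (b : bool)
    (m : nat) : bool :=
  [exists A : {set T}, (#|A| == m) && is_mono c b A].

(* true is the first color, false the second. *)
Definition ramsey_prop (k l n : nat) : bool :=
  (2 <= n) &&
  [forall c : {ffun {set 'I_n} -> bool},
     has_mono_copy c true k || has_mono_copy c false l].

Lemma is_mono_ext (T : finType) (c : {set T} -> bool) b (x : T)
    (A : {set T}) :
  is_mono c b A -> (forall y, y \in A -> c [set x; y] = b) ->
  is_mono c b (x |: A).
Proof.
move=> /forallP mA xA; apply/forallP => e; apply/implyP => /andP[e2 eA].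
have [xe|xe] := boolP (x \in e); last first.
  have := mA e; rewrite e2 /= => /implyP; apply.
  apply/subsetP => y ye.
  have := subsetP eA y ye; rewrite in_setU1 => /orP[/eqP yx|//].
  by rewrite -yx ye in xe.
move: e2 eA xe => /cards2P[u [v [uv ->]]] eA.
have /subsetP eA' := eA.
have uA := eA' u (set21 u v); have vA := eA' v (set22 u v).
rewrite !inE in uA vA; rewrite !inE.
case/orP => /eqP xE.
- by move: vA; rewrite xE (eq_sym v) (negbTE uv) /= => /xA; rewrite xE => ->.
- move: uA; rewrite xE (negbTE uv) /= => /xA; rewrite xE => <-.
  by rewrite setUC.
Qed.

Lemma ramsey_finite (k l : nat) : exists N, forall (T : finType)
    (c : {set T} -> bool) (S : {set T}), N <= #|S| ->
  (exists A : {set T}, [/\ A \subset S, #|A| = k & is_mono c true A]) \/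
  (exists A : {set T}, [/\ A \subset S, #|A| = l & is_mono c false A]).
Proof.
have mono0 (T : finType) (c : {set T} -> bool) b : is_mono c b set0.
  apply/forallP => e; apply/implyP => /andP[/eqP e2].
  by rewrite subset0 => /eqP e0; rewrite e0 cards0 in e2.
elim: k l => [|k IHk] l.
  by exists 0 => T c S _; left; exists set0; rewrite sub0set cards0.
elim: l => [|l [N2 H2]].
  by exists 0 => T c S _; right; exists set0; rewrite sub0set cards0.
have [N1 H1] := IHk l.+1.
exists (N1 + N2).+1 => T c S SN.
have /card_gt0P[x xS] : 0 < #|S| by exact: leq_trans SN.
pose U := [set y | c [set x; y]].
have SxE : #|(S :\ x) :&: U| + #|(S :\ x) :\: U| = #|S :\ x| by exact: cardsID.
have SxC : N1 + N2 <= #|S :\ x| by have := cardsD1 x S; rewrite xS; lia.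
have ext b m (B : {set T}) : B \subset S :\ x ->
    (forall y, y \in B -> c [set x; y] = b) ->
    (exists A : {set T}, [/\ A \subset B, #|A| = m & is_mono c b A]) ->
    exists A : {set T}, [/\ A \subset S, #|A| = m.+1 & is_mono c b A].
  move=> BS Bc [A [AB Am mA]]; exists (x |: A).
  have AS := subset_trans AB BS.
  have /subsetD1P[AS' xA] := AS.
  split; first by rewrite subUset sub1set xS.
    by rewrite cardsU1 xA Am.
  by apply: is_mono_ext => // y yA; apply: Bc; exact: (subsetP AB).
have mono_sub m b (B : {set T}) : B \subset S :\ x ->
    (exists A : {set T}, [/\ A \subset B, #|A| = m & is_mono c b A]) ->
    exists A : {set T}, [/\ A \subset S, #|A| = m & is_mono c b A].
  move=> BS [A [AB Am mA]]; exists A; split=> //.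
  by apply: (subset_trans AB); apply: (subset_trans BS); exact: subD1set.
have [U1|U1] := leqP N1 #|(S :\ x) :&: U|.
  have BS : (S :\ x) :&: U \subset S :\ x by exact: subsetIl.
  have [?|?] := H1 T c _ U1; [left|right].
    by apply: ext BS _ _ => // y; rewrite !inE => /andP[_ ->].
  exact: mono_sub BS _.
have U2 : N2 <= #|(S :\ x) :\: U| by lia.
have BS : (S :\ x) :\: U \subset S :\ x by exact: subsetDl.
have [?|?] := H2 T c _ U2; [left|right].
  exact: mono_sub BS _.
by apply: ext BS _ _ => // y; rewrite !inE => /andP[/negbTE].
Qed.

Lemma ramsey_exists (k l : nat) : exists n, ramsey_prop k l n.
Proof.
have [N HN] := ramsey_finite k l; exists N.+2.
apply/andP; split=> //; apply/forallP => c.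
have leN : N <= #|[set: 'I_N.+2]| by rewrite cardsT card_ord; lia.
have [[A [_ Ak mA]]|[A [_ Al mA]]] := HN 'I_N.+2 c setT leN.
- by apply/orP; left; apply/existsP; exists A; rewrite Ak eqxx.
- by apply/orP; right; apply/existsP; exists A; rewrite Al eqxx.
Qed.

Definition ramsey (k l : nat) : nat := ex_minn (ramsey_exists k l).

(* Main.v *)
Require Import Defs.
From mathcomp Require Import all_boot all_order all_algebra.
From mathcomp Require Import all_classical all_reals all_analysis.
From mathcomp Require Import zify lra ring.
From mathcomp Require Import fintype finset.

(** Colour the edges uniformly at random and apply the Lovasz local lemma to the
    events "the k-set A is monochromatic".  Such an event has probability
    p = 2^(1 - C(k,2)) and is independent of the events of the k-sets sharing no
    edge with A; exactly D = C(n,k) - C(n-k,k) - k C(n-k,k-1) k-sets, A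
    included, meet A in at least two points.  The weight x = 1/(D+1) satisfies
    the local condition p <= x (1-x)^(D-1), because (1 + 1/D)^D <= e.
    Probabilities are replaced by cardinals of sets of colourings. *)

Set Implicit Arguments.
Unset Strict Implicit.
Unset Printing Implicit Defensive.

Import Order.TTheory GRing.Theory Num.Theory.

Local Open Scope ring_scope.

(** * The symmetric local lemma, in counting form *)

Section LocalLemma.
Context {R : realFieldType} {W I : finType}.
Variables (B : I -> {set W}) (nb : I -> {set I}) (K : {set I}).

Definition avoid (F : {set I}) : {set W} :=
  [set w | [forall i in F, w \notin B i]].

Lemma avoid_sub (F G : {set I}) : F \subset G -> avoid G \subset avoid F.
Proof.
move=> FG; apply/subsetP => w; rewrite !inE => /forall_inP H.
by apply/forall_inP => i iF; apply: H; exact: (subsetP FG).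
Qed.

Lemma avoidU1 (i : I) (F : {set I}) : avoid (i |: F) = avoid F :\: B i.
Proof.
apply/setP => w; rewrite !inE; apply/forall_inP/andP => [H|[wi /forall_inP H] j].
  split; first by apply: H; rewrite setU11.
  by apply/forall_inP => j jF; apply: H; rewrite setU1r.
by rewrite !inE => /orP[/eqP->|/H].
Qed.

Variables (p x : R) (d : nat).
Hypotheses (x_ge0 : 0 <= x) (x_lt1 : x < 1) (px : p <= x * (1 - x) ^+ d).
(** Independence enters as a bound on a conditional probability, cleared of its denominator. An
    index may lie in its own [nb i], so [nb_le] discounts it. *)
Hypothesis indep : forall i (F : {set I}), i \in K -> F \subset K ->
  [disjoint F & nb i] -> #|B i :&: avoid F|%:R <= p * #|avoid F|%:R.
Hypothesis nb_le : forall i, i \in K -> (#|nb i :\ i| <= d)%N.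

Lemma avoidU1_ge (i : I) (F : {set I}) :
    #|B i :&: avoid F|%:R <= x * #|avoid F|%:R ->
  (1 - x) * #|avoid F|%:R <= #|avoid (i |: F)|%:R.
Proof.
move=> H; rewrite avoidU1.
have /(congr1 (fun m => m%:R : R)) := cardsID (B i) (avoid F).
rewrite natrD setIC => E; lra.
Qed.

(** Telescoping product: the events of [F1] are added one at a time, and each keeps at least a
    fraction [1 - x] of the points. Restricting the hypothesis to proper subsets lets [bad_le]
    supply it by induction on the size of the family. *)
Lemma avoid_chain (F2 F1 : {set I}) :
    (forall i (G : {set I}), i \in F1 -> i \notin G -> G \proper F2 :|: F1 ->
       #|B i :&: avoid G|%:R <= x * #|avoid G|%:R) ->
  (1 - x) ^+ #|F1| * #|avoid F2|%:R <= #|avoid (F2 :|: F1)|%:R.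
Proof.
have x1 : 0 <= 1 - x by rewrite subr_ge0 ltW.
move: {2}#|F1| (erefl #|F1|) => m; elim: m F1 => [|m IH] F1 F1m H.
  by rewrite (cards0_eq F1m) cards0 expr0 mul1r setU0.
have /card_gt0P[i iF] : (0 < #|F1|)%N by rewrite F1m.
have F1E := setD1K iF.
have F1'm : #|F1 :\ i| = m by have := cardsD1 i F1; rewrite iF; lia.
(* An event already in [F2] removes nothing, and its factor [1 - x] is at most 1. *)
have [iF2|iF2] := boolP (i \in F2).
  have E : F2 :|: F1 = F2 :|: (F1 :\ i).
    rewrite -{1}F1E setUA (setUC F2 [set i]).
    have iF2s : [set i] \subset F2 by rewrite sub1set.
    by rewrite (setUidPr iF2s).
  have := IH _ F1'm; rewrite -E => {}IH.
  rewrite F1m exprS; apply: (@le_trans _ _ ((1 - x) ^+ m * #|avoid F2|%:R)).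
    by rewrite -mulrA ler_piMl ?mulr_ge0 ?exprn_ge0 ?gerBl.
  rewrite -F1'm; apply: IH => j G jF; apply: H.
  by move: jF; rewrite in_setD1 => /andP[].
have iG : i \notin F2 :|: F1 :\ i by rewrite !inE negb_or iF2 eqxx.
have E : F2 :|: F1 = i |: (F2 :|: (F1 :\ i)) by rewrite setUCA F1E.
have P : F2 :|: F1 :\ i \proper F2 :|: F1.
  by rewrite E; apply: properUr; rewrite sub1set.
rewrite E; apply: le_trans (avoidU1_ge _); last first.
  by apply: H.
rewrite F1m exprS -mulrA; apply: ler_wpM2l => //; rewrite -F1'm; apply: IH => //.
move=> j G jF jG GP; apply: H => //.
  by move: jF; rewrite in_setD1 => /andP[].
exact: proper_trans GP P.
Qed.

(** Strong induction on [#|F|]. Let [F2] be the part of [F] outside [nb i]: the left side is at most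
    [p * #|avoid F2|], while restoring the at most [d] neighbours costs at most a factor
    [(1 - x) ^+ d]; then [px] concludes. *)
Lemma bad_le (F : {set I}) (i : I) : F \subset K -> i \in K -> i \notin F ->
  #|B i :&: avoid F|%:R <= x * #|avoid F|%:R.
Proof.
have x1 : 0 <= 1 - x by rewrite subr_ge0 ltW.
move: {2}#|F|.+1 (leqnn #|F|.+1) => m; elim: m F i => // m IH F i Fm FK iK iF.
pose F2 := F :\: nb i; pose F1 := F :&: nb i.
have FE : F2 :|: F1 = F by rewrite setUC setID.
(* Since [i] is not in [F], the set [F1] lies in [nb i :\ i]. *)
have F1d : (#|F1| <= d)%N.
  apply: leq_trans (nb_le iK); apply: subset_leq_card.
  apply/subsetP => j; rewrite !inE => /andP[jF ->]; rewrite andbT.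
  by apply: contraNneq iF => <-.
have chain : (1 - x) ^+ #|F1| * #|avoid F2|%:R <= #|avoid F|%:R.
  have := @avoid_chain F2 F1; rewrite FE; apply=> j G jF1 jG GF.
  apply: IH => //.
  - exact: leq_trans (proper_card GF) _.
  - exact: subset_trans (proper_sub GF) FK.
  - by move: jF1; rewrite inE => /andP[/(subsetP FK)].
have sub : #|B i :&: avoid F|%:R <= #|B i :&: avoid F2|%:R :> R.
  rewrite ler_nat; apply/subset_leq_card/setIS/avoid_sub.
  exact: subsetDl.
apply: (le_trans sub); apply: (@le_trans _ _ (p * #|avoid F2|%:R)).
  apply: indep => //; first exact: subset_trans (subsetDl _ _) FK.
  by rewrite -setI_eq0 setIDAC setDIl setDv setI0.
apply: le_trans (ler_wpM2l x_ge0 chain).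
rewrite mulrA ler_wpM2r //; apply: (le_trans px); rewrite ler_wpM2l //.
by rewrite ler_wiXn2l // gerBl.
Qed.

Theorem local_lemma : (0 < #|W|)%N ->
  exists w, forall i, i \in K -> w \notin B i.
Proof.
move=> W0.
have E0 : avoid set0 = [set: W].
  by apply/setP => w; rewrite !inE; apply/forall_inP => i; rewrite inE.
(* Started from the empty family, the chain leaves at least [(1 - x) ^+ #|K| * #|W|] points, a
   positive number. *)
have := @avoid_chain set0 K.
rewrite set0U E0 cardsT => H.
have : 0 < #|avoid K|%:R :> R.
  apply: lt_le_trans (H _).
    by rewrite mulr_gt0 ?ltr0n // exprn_gt0 // subr_gt0.
  move=> i G iK iG GK; apply: bad_le => //; exact: proper_sub.
rewrite ltr0n => /card_gt0P[w]; rewrite inE => /forall_inP Hw; by exists w.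
Qed.

End LocalLemma.

(** * Monochromatic events: independence and counting of neighbours *)

Section Colourings.
Context {T : finType}.
Implicit Types (A C : {set T}) (F : {set {set T}}) (b : bool).

Definition mono_set A : {set {ffun {set T} -> bool}} :=
  [set c : {ffun {set T} -> bool} | is_mono c true A || is_mono c false A].

Definition edges A : {set {set T}} := [set e : {set T} | e \subset A & #|e| == 2].

Lemma is_monoP (c : {set T} -> bool) b A :
  reflect {in edges A, forall e, c e = b} (is_mono c b A).
Proof.
apply: (iffP forallP) => H e.
  by rewrite inE => /andP[eA e2]; have := H e; rewrite e2 eA => /eqP.
by apply/implyP => /andP[e2 eA]; apply/eqP/H; rewrite inE eA.
Qed.

Lemma disjoint_edges A C : (#|A :&: C| <= 1)%N -> [disjoint edges A & edges C].
Proof.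
move=> AC; rewrite -setI_eq0; apply/eqP/setP => e; rewrite !inE.
apply/negP => /andP[/andP[eA /eqP e2] /andP[eC _]].
have /subset_leq_card : e \subset A :&: C by rewrite subsetI eA.
by rewrite e2; lia.
Qed.

Lemma mono_set_eq_off A C (c c' : {ffun {set T} -> bool}) :
    (#|A :&: C| <= 1)%N -> (forall e, e \notin edges A -> c e = c' e) ->
  (c \in mono_set C) = (c' \in mono_set C).
Proof.
move=> /disjoint_edges AC cc'.
have E e : e \in edges C -> c e = c' e.
  by move=> eC; apply: cc'; rewrite (disjointFl AC eC).
have M b : is_mono c b C = is_mono c' b C.
  by apply/is_monoP/is_monoP => H e eC; [rewrite -E|rewrite E] => //; exact: H.
by rewrite !inE !M.
Qed.

(* Recolouring the edges of A arbitrarily turns each colouring that is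
   constantly b on A into 2 ^ C(#|A|, 2) colourings. *)
Lemma card_mono_avoid b A F : {in F, forall C, (#|A :&: C| <= 1)%N} ->
  (#|[set c : {ffun {set T} -> bool} | is_mono c b A] :&: avoid mono_set F|
    * 2 ^ 'C(#|A|, 2) <= #|avoid mono_set F|)%N.
Proof.
move=> AF; rewrite -cards_draws -/(edges A) -card_powerset -cardsX.
(* [f] overwrites [c] on the edges of [A] by the indicator of [S]. No member of [F] shares an edge
   with [A], so avoidance of [F] survives. *)
pose f (u : {ffun {set T} -> bool} * {set {set T}}) :=
  [ffun e => if e \in edges A then e \in u.2 else u.1 e].
rewrite -(card_in_imset (f := f)).
  apply/subset_leq_card/subsetP => _ /imsetP[[c S] + ->].
  rewrite !inE /= => /andP[/andP[_ /forall_inP cF] _].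
  apply/forall_inP => C CF; rewrite (@mono_set_eq_off A _ _ c) ?cF ?AF // => e eA.
  by rewrite ffunE (negbTE eA).
move=> [c S] [c' S']; rewrite !inE /=.
move=> /andP[/andP[/is_monoP cA _] SA] /andP[/andP[/is_monoP cA' _] SA'] ff.
have fe e := congr1 (fun g : {ffun {set T} -> bool} => g e) ff.
(* The overwritten values of [c] are known to be [b], so [c] is recovered, and [S] is read off on
   the edges of [A]. *)
congr pair.
  apply/ffunP => e; have := fe e; rewrite !ffunE /=.
  by case: ifPn => // eA _; rewrite cA ?cA'.
apply/setP => e; have := fe e; rewrite !ffunE /=.
case: ifPn => // eA _.
by rewrite !(contraNF (subsetP _ e) eA).
Qed.

(** Union bound over the two colours, the source of the factor 2 in the probability [p]. *)
Lemma card_mono_set_avoid A F : {in F, forall C, (#|A :&: C| <= 1)%N} ->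
  (#|mono_set A :&: avoid mono_set F| * 2 ^ 'C(#|A|, 2)
    <= 2 * #|avoid mono_set F|)%N.
Proof.
move=> AF; have H1 := card_mono_avoid true AF; have H2 := card_mono_avoid false AF.
have -> : mono_set A = [set c : {ffun {set T} -> bool} | is_mono c true A]
    :|: [set c : {ffun {set T} -> bool} | is_mono c false A].
  by apply/setP => c; rewrite !inE.
rewrite setIUl mul2n -addnn.
by apply: leq_trans (leq_add H1 H2); rewrite -mulnDl leq_mul2r leq_card_setU orbT.
Qed.

(** The dependency neighbourhood of [A]: sharing two points is the same as sharing an edge. *)
Definition overlapping (k : nat) A : {set {set T}} :=
  [set C : {set T} | #|C| == k & (1 < #|A :&: C|)%N].

(** The [k]-sets meeting [A] in no point ([X0]) and in exactly one point ([X1]) are disjoint from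
    each other and from the overlapping ones. *)
Lemma card_overlapping (k : nat) A : #|A| = k -> (0 < k)%N ->
  (#|overlapping k A| + ('C(#|T| - k, k) + k * 'C(#|T| - k, k.-1))
    <= 'C(#|T|, k))%N.
Proof.
move=> Ak k0.
have cA : #|~: A| = (#|T| - k)%N by have := cardsC A; lia.
pose X0 := [set C : {set T} | C \subset ~: A & #|C| == k].
pose Y := [set C : {set T} | C \subset ~: A & #|C| == k.-1].
pose X1 := [set u.1 |: u.2 | u in setX A Y].
(* [AI] and [CI] recover both components of a pair from the union, so [X1] is counted without
   repetition. *)
have AI a (C : {set T}) : a \in A -> C \subset ~: A -> A :&: (a |: C) = [set a].
  move=> aA CA; apply/setP => z; rewrite !inE.
  have [->|_ /=] := eqVneq z a; first by rewrite aA.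
  by apply/andP => -[zA /(subsetP CA)]; rewrite inE zA.
have CI a (C : {set T}) : a \in A -> C \subset ~: A -> (a |: C) :\: A = C.
  move=> aA CA; apply/setP => z; rewrite !inE.
  have [zC|zC] := boolP (z \in C).
    by move: (subsetP CA z zC); rewrite inE orbT => ->.
  by rewrite orbF; have [->|_] := eqVneq z a; rewrite ?aA ?andbF.
have X0c : #|X0| = 'C(#|T| - k, k) by rewrite cards_draws cA.
have X1c : #|X1| = (k * 'C(#|T| - k, k.-1))%N.
  rewrite card_in_imset ?cardsX ?cards_draws ?cA ?Ak //.
  move=> [a C] [a' C']; rewrite !inE /=.
  move=> /andP[aA /andP[CA _]] /andP[aA' /andP[CA' _]] E.
  congr pair; last by rewrite -(CI a C aA CA) E CI.
  by apply: set1_inj; rewrite -(AI a C aA CA) E AI.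
have X1I C : C \in X1 -> #|C| = k /\ #|A :&: C| = 1%N.
  move=> /imsetP[[a D]]; rewrite !inE /= => /andP[aA /andP[DA /eqP Dk]] ->.
  rewrite AI // cards1 cardsU1 Dk; split=> //.
  have -> : a \notin D by apply: contraL aA => /(subsetP DA); rewrite inE.
  by rewrite /=; lia.
have X0I C : C \in X0 -> #|C| = k /\ #|A :&: C| = 0%N.
  rewrite inE => /andP[CA /eqP Ck]; split=> //; apply/eqP.
  by rewrite cards_eq0 setI_eq0 disjoint_sym -[A]setCK disjoints_subset setCK.
rewrite -X0c -X1c -(card_draws T k).
have d1 : X0 :&: X1 = set0.
  apply/setP => C; rewrite !in_setI in_set0; apply/negP => /andP[].
  by move=> /X0I[_ AC0] /X1I[_]; rewrite AC0.
have d2 : overlapping k A :&: (X0 :|: X1) = set0.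
  apply/setP => C; rewrite in_setI in_setU in_set0; apply/negP => /andP[].
  by rewrite inE => /andP[_ AC1] /orP[/X0I|/X1I] [_ cAC]; rewrite cAC in AC1.
have := cardsUI X0 X1; rewrite d1 cards0 addn0 => <-.
have := cardsUI (overlapping k A) (X0 :|: X1); rewrite d2 cards0 addn0 => <-.
apply/subset_leq_card/subsetP => C; rewrite [X in _ -> is_true X]inE !in_setU.
by move=> /or3P[|/X0I[->]//|/X1I[->]//]; rewrite inE => /andP[].
Qed.

End Colourings.

(** * From a good colouring to a lower bound on the Ramsey number *)

Lemma has_mono_copy_imset (S T : finType) (f : S -> T) (c : {set T} -> bool) b m :
  injective f -> has_mono_copy (fun e : {set S} => c (f @: e)) b m ->
  has_mono_copy c b m.
Proof.
move=> f_inj /existsP[A /andP[/eqP Am /is_monoP cA]].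
apply/existsP; exists (f @: A); rewrite card_imset // Am eqxx /=.
apply/is_monoP => e; rewrite inE => /andP[eA /eqP e2].
have E : f @: (f @^-1: e) = e.
  apply/setP => z; apply/imsetP/idP => [[y + ->]|ze]; first by rewrite inE.
  by have /imsetP[y _ zy] := subsetP eA z ze; exists y; rewrite ?inE -?zy.
rewrite -E; apply: cA; rewrite inE; apply/andP; split.
  apply/subsetP => y; rewrite inE => /(subsetP eA)/imsetP[y' y'A].
  by move=> /f_inj ->.
by rewrite -(card_imset _ f_inj) E e2.
Qed.

(** If the Ramsey number [m] were at most [n], restricting [c] to the first [m] vertices would
    produce a forbidden copy, which [widen_ord] carries back to ['I_n]. *)
Lemma ramsey_gt (k l n : nat) (c : {set 'I_n} -> bool) :
  ~~ has_mono_copy c true k -> ~~ has_mono_copy c false l -> (n < ramsey k l)%N.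
Proof.
move=> ck cl; rewrite /ramsey; case: ex_minnP => m /andP[_ /forallP Hm] _.
rewrite ltnNge; apply/negP => mn.
have f_inj : injective (widen_ord mn) by move=> i j /(congr1 val) /= /val_inj.
pose c' := [ffun e : {set 'I_m} => c (widen_ord mn @: e)].
have c'E : c' = (fun e : {set 'I_m} => c (widen_ord mn @: e)) :> (_ -> _).
  by apply: funext => e; rewrite ffunE.
have mono b r : has_mono_copy c' b r -> has_mono_copy c b r.
  by rewrite c'E; exact: has_mono_copy_imset.
by have /orP[/mono|/mono] := Hm c'; [apply/negP|apply/negP].
Qed.

(** * The numerical condition on the weight *)

Lemma expR1_ge_compound (R : realType) (D : nat) :
  (0 < D)%N -> (1 + D%:R^-1) ^+ D <= expR 1 :> R.
Proof.
move=> D0; have D0' : D%:R != 0 :> R by rewrite pnatr_eq0 -lt0n.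
apply: (@le_trans _ _ (expR (D%:R^-1) ^+ D)).
  by rewrite lerXn2r ?nnegrE ?expR_ge0 ?addr_ge0 ?invr_ge0 // expR_ge1Dx.
by rewrite -expRM_natl mulfV.
Qed.

(** With [D = d.+1] and [q = 1 + 1/D], the weight is [1/(D q)] and its complement [1/q], so the
    right side equals [1/(D q^D)], which is at least [1/(e D)]. *)
Lemma local_condition (R : realType) (p : R) (d : nat) :
    0 <= p -> expR 1 * d.+1%:R * p <= 1 ->
  p <= d.+2%:R^-1 * (1 - d.+2%:R^-1) ^+ d.
Proof.
move=> p0 H.
have D0 : 0 < d.+1%:R :> R by rewrite ltr0n.
have D1 : 0 < d.+2%:R :> R by rewrite ltr0n.
pose q : R := d.+2%:R / d.+1%:R.
have q0 : 0 < q by rewrite divr_gt0.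
have qE : 1 + d.+1%:R^-1 = q :> R.
  by rewrite /q -[d.+2]addn1 natrD mulrDl mulfV ?gt_eqF // mul1r.
have xE : 1 - d.+2%:R^-1 = q^-1 :> R.
  have : d.+2%:R = d.+1%:R + 1 :> R by rewrite natr1.
  move=> E; rewrite /q invf_div; apply: (canRL (mulfK (lt0r_neq0 D1))).
  by rewrite mulrBl mul1r mulVf ?lt0r_neq0 // E addrK.
have iE : d.+2%:R^-1 = (d.+1%:R * q)^-1 :> R.
  by rewrite /q mulrCA mulfV ?gt_eqF // mulr1.
rewrite xE iE exprVn -invfM -mulrA -exprS -div1r.
rewrite ler_pdivlMr ?mulr_gt0 ?exprn_gt0 //; apply: le_trans H.
rewrite (mulrC _ p) (mulrC (expR 1)) ler_wpM2l // (ler_pM2l D0).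
by rewrite -qE; exact: expR1_ge_compound.
Qed.

(** * The diagonal Ramsey bound *)

Theorem theorem7 (R : realType) (k n : nat) (hk : (2 <= k)%N) (hn : (2 <= n)%N)
    (h : expR (1 : R) *
         ('C(n, k)%:R - 'C(n - k, k)%:R - k%:R * 'C(n - k, k.-1)%:R) *
         2 ^ (1 - 'C(k, 2)%:Z) <= 1) :
  (n < ramsey k k)%N.
Proof.
suff [c Hc] : exists c : {ffun {set 'I_n} -> bool},
    forall A, A \in [set A : {set 'I_n} | #|A| == k] -> c \notin mono_set A.
  have no b : ~~ has_mono_copy c b k.
    apply/existsP => -[A /andP[Ak cA]]; have := Hc A; rewrite !inE => /(_ Ak).
    by case: b cA => ->; rewrite ?orbT.
  exact: (ramsey_gt (no true) (no false)).
(* When [n < k] there is no [k]-set, so any colouring works. *)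
have [nk|kn] := ltnP n k.
  exists [ffun=> true] => A; rewrite inE => /eqP Ak.
  by have := max_card A; rewrite card_ord; lia.
have over (A : {set 'I_n}) : #|A| = k -> _ :=
  fun Ak => card_overlapping Ak (ltnW hk).
have self (A : {set 'I_n}) : #|A| = k -> A \in overlapping k A.
  by move=> Ak; rewrite inE setIid Ak eqxx.
rewrite card_ord in over.
set m := ('C(n - k, k) + k * 'C(n - k, k.-1))%N in over.
have [A0 A0k] : exists A : {set 'I_n}, #|A| = k.
  have : (0 < #|[set A : {set 'I_n} | #|A| == k]|)%N.
    by rewrite card_draws card_ord bin_gt0.
  by move=> /card_gt0P[A]; rewrite inE => /eqP; exists A.
(* The bracket in [h] is positive because [A0] overlaps itself. It is written [d.+1] so that [d]
   bounds the number of neighbours other than the set itself. *)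
have [d dE] : exists d, ('C(n, k) = d.+1 + m)%N.
  exists ('C(n, k) - m).-1; have := over _ A0k.
  have : (0 < #|overlapping k A0|)%N by apply/card_gt0P; exists A0; exact: self.
  by lia.
have hD : 'C(n, k)%:R - 'C(n - k, k)%:R - k%:R * 'C(n - k, k.-1)%:R = d.+1%:R :> R.
  by rewrite dE /m !natrD natrM; ring.
rewrite hD in h.
set p : R := 2 ^ _ in h.
have p0 : 0 <= p by rewrite exprz_ge0.
(* This form matches the two sides of [card_mono_set_avoid]. *)
have pE : p * (2 ^ 'C(k, 2))%:R = 2.
  rewrite natrX /p expfzDr ?pnatr_eq0 // expr1z -exprnN.
  by rewrite mulfVK // expf_neq0 // pnatr_eq0.
apply: (@local_lemma R _ _ mono_set (overlapping k) _ p (d.+2%:R^-1) d).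
- by rewrite invr_ge0.
- by rewrite invf_lt1 ?ltr0n // ltr1n.
- exact: local_condition.
- move=> A F; rewrite inE => /eqP Ak FK AF.
  have : {in F, forall C, (#|A :&: C| <= 1)%N}.
    move=> C CF; rewrite leqNgt; apply: contraFN (disjointFr AF CF) => AC.
    by have := subsetP FK C CF; rewrite !inE AC andbT.
  move=> /card_mono_set_avoid; rewrite Ak -(ler_nat R) !natrM -pE.
  by rewrite mulrAC ler_pM2r // ltr0n expn_gt0.
- move=> A; rewrite inE => /eqP Ak; have := over _ Ak.
  by rewrite (cardsD1 A (overlapping k A)) self // dE; lia.
- by apply/card_gt0P; exists [ffun=> true].
Qed.
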